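(* Let $X=Y$ be $n$ uniformly distributed points and let $\mathcal T$ be the associated perfect binary tree with $L$ levels, where $n$ is of the order of $r2^L$ for a positive integer $r$. Suppose the rank of the HSS generators is at most $r$, that $|\bar{\mathbf i}^{row}|\le 2r$ and $|\bar{\mathbf i}^{col}|\le 2r$ for every nonroot node $i$, and that each nearfield set $\mathcal N_i$ has at most $3$ elements. Then the complexity of the SMASH HSS construction (described in the context) is $O(n)$, with $r$ regarded as a constant.
   Context: Problem. Given $A=[\kappa(x,y)]_{x\in X,y\in Y}$ of order $n$ (entries computable at unit cost) and a perfect binary tree $\mathcal T$ with $L$ levels (root at level $1$, leaves at level $L$) of subdomains $\Omega_i$, construct an HSS approximation of $A$. $\mathbf i^{row}$, $\mathbf i^{col}$ are the indices of points of $X$, $Y$ in $\Omega_i$; the tree, these index sets for leaves and the sets $\mathcal N_i$ are given. Here Sep is the set of pairs $(i,j)$ with $\Omega_i,\Omega_j$ well-separated, i.e. $\delta_i+\delta_j\le\tau|a_i-a_j|$ for the centers $a$ and radii $\delta$ of their smallest enclosing balls, with $\tau\in(0,1)$ fixed; $\mathcal N_{root}=\emptyset$, and for $i$ nonroot with parent $p_i$, $\mathcal N_i$ consists of the sibling of $i$ and of the nodes $k$ with $p_k\in\mathcal N_{p_i}$ and $(i,k)\notin$ Sep. Compression routine. For $M$ with rows indexed by $\mathbf k$, $[P,G,\hat{\mathbf k}]=\mathrm{compr}(M,\mathbf k)$ (strong rank-revealing QR of $M^T$ with fixed parameter $s>1$) returns $\hat{\mathbf k}\subseteq\mathbf k$,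 a permutation matrix $P$ and a matrix $G$ with entries bounded by $s$ such that $M=P\begin{bmatrix} I \\ G \end{bmatrix}M|_{\hat{\mathbf k}}$. Construction. For a leaf $i$, $\bar{\mathbf i}^{row}=\mathbf i^{row}$, $\bar{\mathbf i}^{col}=\mathbf i^{col}$. For $l=L,L-1,\dots,2$ and each node $i$ at level $l$: (a) form farfield basis matrices $\hat U_i,\hat V_i$ with rows indexed by $\bar{\mathbf i}^{row},\bar{\mathbf i}^{col}$ and at most $r$ columns, by evaluating explicit functions (e.g. Taylor or interpolation basis functions) at the points, at unit cost per entry; (b) compute the left singular vectors $S_i$, $T_i$ kept by truncated SVDs of $[A|_{\bar{\mathbf i}^{row}\times\bar{\mathbf j}^{col}}]_{j\in\mathcal N_i}$ and $[(A|_{\bar{\mathbf j}^{row}\times\bar{\mathbf i}^{col}})^T]_{j\in\mathcal N_i}$; (c) compute $[P_i,G_i,\hat{\mathbf i}^{row}]=\mathrm{compr}([\hat U_i,S_i],\bar{\mathbf i}^{row})$ and $[F_i,H_i,\hat{\mathbf i}^{col}]=\mathrm{compr}([\hat V_i,T_i],\bar{\mathbf i}^{col})$. For a parent $p$ with children $c_1,c_2$, $\bar{\mathbf p}^{row}=\hat{\mathbf c}_1^{row}\cup\hat{\mathbf c}_2^{row}$, $\bar{\mathbf p}^{col}=\hat{\mathbf c}_1^{col}\cup\hat{\mathbf c}_2^{col}$. The matrices $P_i\begin{bmatrix} I \\ G_i \end{bmatrix}$, $F_i\begin{bmatrix} I \\ H_i \end{bmatrix}$ are the basis generators (leaf $i$)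 or stacked transfer generators of the two children (nonleaf $i$). Finally $B_i=A|_{\hat{\mathbf i}^{row}\times\hat{\mathbf j}^{col}}$ ($j$ the sibling of $i$) and $D_i=A|_{\mathbf i^{row}\times\mathbf i^{col}}$ ($i$ a leaf) are extracted as submatrices of $A$. Cost model. Complexity is the number of arithmetic operations and kernel evaluations. The truncated SVD and the strong rank-revealing QR of a matrix both of whose dimensions are bounded by a fixed multiple of $r$ are taken to cost $O(r^3)$ operations (with $s$ fixed). *)

(* Defs.v *)
From mathcomp Require Import all_boot all_order all_algebra.
From mathcomp Require Import boolp classical_sets reals.

Set Implicit Arguments.
Unset Strict Implicit.
Unset Printing Implicit Defensive.
Import Order.TTheory GRing.Theory Num.Theory.
Local Open Scope ring_scope.

(** The first component counts arithmetic operations, kernel evaluations and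
    evaluations of basis functions.  Indexing, concatenation and unions of
    index sets are free, and so are the input data: the tree, the index sets of
    the leaves and the nearfield lists. *)

Definition Cost (T : Type) : Type := (nat * T)%type.
Definition cost (T : Type) (c : Cost T) : nat := c.1.
Definition result (T : Type) (c : Cost T) : T := c.2.

Definition ret (T : Type) (x : T) : Cost T := (0%N, x).
Definition bind (T S : Type) (c : Cost T) (f : T -> Cost S) : Cost S :=
  ((cost c + cost (f (result c)))%N, result (f (result c))).
Definition unit_cost (T : Type) (x : T) : Cost T := (1%N, x).

Notation "x <~ c ;; e" := (bind c (fun x => e))
  (at level 100, c at next level, right associativity).

Fixpoint foldC (T S : Type) (f : S -> T -> Cost S) (st : S) (xs : seq T)
    : Cost S :=
  if xs is x :: xs' then st' <~ f st x;; foldC f st' xs' else ret st.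

Fixpoint mapC (T S : Type) (f : T -> Cost S) (xs : seq T) : Cost (seq S) :=
  if xs is x :: xs' then y <~ f x;; ys <~ mapC f xs';; ret (y :: ys)
  else ret [::].

Definition matrixC (R : Type) (m q : nat) (f : 'I_m -> 'I_q -> Cost R)
    : Cost 'M[R]_(m, q) :=
  ((\sum_(i < m) \sum_(j < q) cost (f i j))%N,
   \matrix_(i, j) result (f i j)).

(** A node is its path, last step first: [[::]] is the root, and [b :: p] is a
    child of [p]. *)
Definition node : Type := seq bool.

Definition level (i : node) : nat := (size i).+1.

Definition sibling (i : node) : node := if i is b :: p then ~~ b :: p else [::].

Definition level_nodes (l : nat) : seq node :=
  [seq val t | t : (l.-1).-tuple bool].

(** The nonroot nodes, from level [L] up to level 2. *)
Definition bottom_up (L : nat) : seq node :=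
  flatten [seq level_nodes l | l <- rev (iota 2 L.-1)].

Lemma card_ord_compl (m : nat) (K : {set 'I_m}) : (#|K| + (m - #|K|) = m)%N.
Proof. by rewrite subnKC // -[leqRHS]card_ord max_card. Qed.

(** Rows are designated by their positions, here and in the routine [compr];
    [global] below translates positions into indices. *)
Record compr_out (R : Type) (m : nat) : Type := ComprOut {
  kept : {set 'I_m};
  permP : 'M[R]_m;
  coefG : 'M[R]_(m - #|kept|, #|kept|) }.

Definition interp_mx (R : realType) (m : nat) (o : compr_out R m)
    : 'M[R]_(m, #|kept o|) :=
  permP o *m castmx (card_ord_compl (kept o), erefl) (col_mx 1%:M (coefG o)).

Record routines (R : realType) : Type := Routines {
  tsvd : forall m q : nat, 'M[R]_(m, q) -> Cost {k : nat & 'M[R]_(m, k)};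
  compr : forall m q : nat, 'M[R]_(m, q) -> Cost (compr_out R m) }.

Definition is_svd (R : realType) (m q : nat) (M : 'M[R]_(m, q))
    (U : 'M[R]_(m, minn m q)) (sigma : 'rV[R]_(minn m q))
    (V : 'M[R]_(q, minn m q)) : Prop :=
  [/\ U^T *m U = 1%:M, V^T *m V = 1%:M,
      forall i, 0 <= sigma 0 i,
      forall i j : 'I_(minn m q), (i <= j)%N -> sigma 0 j <= sigma 0 i
    & M = U *m diag_mx sigma *m V^T].

(** The criterion by which the number [k] of kept vectors is chosen (a
    tolerance, a prescribed rank) is left free. *)
Definition tsvd_correct (R : realType) (rt : routines R) : Prop :=
  forall (m q : nat) (M : 'M[R]_(m, q)),
    exists U sigma V, is_svd M U sigma V /\
    exists le_k : (tag (result (tsvd rt M)) <= minn m q)%N,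
      tagged (result (tsvd rt M)) = colsub (widen_ord le_k) U.

Definition compr_correct (R : realType) (s : R) (rt : routines R) : Prop :=
  forall (m q : nat) (M : 'M[R]_(m, q)),
    let o := result (compr rt M) in
    [/\ is_perm_mx (permP o), forall i j, `|coefG o i j| <= s
      & M = interp_mx o *m rowsub (fun k => @enum_val _ (mem (kept o)) k) M].

Definition cubic_cost (R : realType)
    (f : forall m q : nat, 'M[R]_(m, q) -> nat) : Prop :=
  forall mu : nat, exists c : nat,
    forall (r m q : nat) (M : 'M[R]_(m, q)),
      (0 < r)%N -> (m <= mu * r)%N -> (q <= mu * r)%N ->
      (f m q M <= c * r ^ 3)%N.

(** [center] and [radius] are those of the smallest enclosing ball of the
    subdomain [dom]; see [domain_tree].  [row_basis i] and [col_basis i] list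
    the functions whose values at the points are the columns of the farfield
    bases of the node [i]. *)
Record problem (R : realType) (d n : nat) : Type := Problem {
  kernel : 'rV[R]_d -> 'rV[R]_d -> R;
  ptX : 'I_n -> 'rV[R]_d;
  ptY : 'I_n -> 'rV[R]_d;
  dom : node -> set 'rV[R]_d;
  center : node -> 'rV[R]_d;
  radius : node -> R;
  row_basis : node -> seq ('rV[R]_d -> R);
  col_basis : node -> seq ('rV[R]_d -> R) }.

Definition enorm (R : realType) (d : nat) (x : 'rV[R]_d) : R :=
  Num.sqrt (\sum_(k < d) x 0 k ^+ 2).

Definition enclosing_ball (R : realType) (d : nat) (A : set 'rV[R]_d)
    (a : 'rV[R]_d) (delta : R) : Prop :=
  0 <= delta /\ forall x, A x -> enorm (x - a) <= delta.

Definition smallest_enclosing_ball (R : realType) (d : nat)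
    (A : set 'rV[R]_d) (a : 'rV[R]_d) (delta : R) : Prop :=
  enclosing_ball A a delta /\
  forall a' delta', enclosing_ball A a' delta' -> delta <= delta'.

Section Construction.
Variables (R : realType) (d n : nat) (pb : problem R d n).
Variables (rt : routines R) (tau : R) (L : nat).

Definition row_idx (i : node) : {set 'I_n} := [set k | ptX pb k \in dom pb i].
Definition col_idx (i : node) : {set 'I_n} := [set k | ptY pb k \in dom pb i].

Definition domain_tree : Prop :=
  [/\ row_idx [::] = [set: 'I_n] /\ col_idx [::] = [set: 'I_n],
      forall p : node, (level p < L)%N ->
        dom pb p = (dom pb (false :: p) `|` dom pb (true :: p))%classic,
      forall p : node, (level p < L)%N ->
        [disjoint row_idx (false :: p) & row_idx (true :: p)] /\
        [disjoint col_idx (false :: p) & col_idx (true :: p)]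
    & forall i : node, (level i <= L)%N ->
        smallest_enclosing_ball (dom pb i) (center pb i) (radius pb i)].

(** Each subdomain holds, up to the factor [K], its share of the [n] points of
    [X], the [2 ^ (l - 1)] subdomains of level [l] having equal shares. *)
Definition uniformly_distributed (K : nat) : Prop :=
  forall i : node, (level i <= L)%N ->
    (n <= K * (2 ^ (level i).-1 * #|row_idx i|))%N /\
    (2 ^ (level i).-1 * #|row_idx i| <= K * n)%N.

Definition well_separated (i j : node) : bool :=
  radius pb i + radius pb j <= tau * enorm (center pb i - center pb j).

(** This list has no repetitions: [p] is not in [nearfield p], so the sibling
    does not reappear among the other nodes. *)
Fixpoint nearfield (i : node) : seq node :=
  if i is b :: p then
    sibling i :: [seq k <- [seq c :: q | q <- nearfield p, c <- [:: false; true]]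
                    | ~~ well_separated i k]
  else [::].

Definition entry (k l : 'I_n) : Cost R :=
  unit_cost (kernel pb (ptX pb k) (ptY pb l)).

Definition submatrixA (I J : {set 'I_n}) : Cost 'M[R]_(#|I|, #|J|) :=
  matrixC (fun a b => entry (enum_val a) (enum_val b)).

Definition eval_basis (pt : 'I_n -> 'rV[R]_d) (I : {set 'I_n})
    (phis : seq ('rV[R]_d -> R)) : Cost 'M[R]_(#|I|, size phis) :=
  matrixC (fun a b => unit_cost (tnth (in_tuple phis) b (pt (enum_val a)))).

Record node_data : Type := NodeData {
  nd_row : {set 'I_n};
  nd_col : {set 'I_n};
  row_compr : compr_out R #|nd_row|;
  col_compr : compr_out R #|nd_col| }.

Definition global (I : {set 'I_n}) (o : compr_out R #|I|) : {set 'I_n} :=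
  [set enum_val k | k in kept o].

Definition table : Type := node -> option node_data.

Definition update (t : table) (i : node) (x : node_data) : table :=
  fun j => if j == i then Some x else t j.

Definition hat_row (t : table) (i : node) : {set 'I_n} :=
  if t i is Some x then global (row_compr x) else finset.set0.
Definition hat_col (t : table) (i : node) : {set 'I_n} :=
  if t i is Some x then global (col_compr x) else finset.set0.

Definition bar_row (t : table) (i : node) : {set 'I_n} :=
  if level i == L then row_idx i
  else hat_row t (false :: i) :|: hat_row t (true :: i).
Definition bar_col (t : table) (i : node) : {set 'I_n} :=
  if level i == L then col_idx i
  else hat_col t (false :: i) :|: hat_col t (true :: i).

(** The blocks, for [j] in the nearfield of [i], side by side. *)
Definition near_cols (t : table) (i : node) : seq 'I_n :=
  flatten [seq enum (bar_col t j) | j <- nearfield i].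
Definition near_rows (t : table) (i : node) : seq 'I_n :=
  flatten [seq enum (bar_row t j) | j <- nearfield i].

Definition near_row_block (t : table) (i : node)
    : Cost 'M[R]_(#|bar_row t i|, size (near_cols t i)) :=
  matrixC (fun a b => entry (enum_val a) (tnth (in_tuple (near_cols t i)) b)).
Definition near_col_block (t : table) (i : node)
    : Cost 'M[R]_(#|bar_col t i|, size (near_rows t i)) :=
  matrixC (fun a b => entry (tnth (in_tuple (near_rows t i)) b) (enum_val a)).

Definition process_node (t : table) (i : node) : Cost table :=
  U <~ eval_basis (ptX pb) (bar_row t i) (row_basis pb i);;
  V <~ eval_basis (ptY pb) (bar_col t i) (col_basis pb i);;
  NR <~ near_row_block t i;;
  S <~ tsvd rt NR;;
  NC <~ near_col_block t i;;
  T <~ tsvd rt NC;;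
  PG <~ compr rt (row_mx U (tagged S));;
  FH <~ compr rt (row_mx V (tagged T));;
  ret (update t i (NodeData PG FH)).

Definition any_matrix : Type := {mq : nat * nat & 'M[R]_(mq.1, mq.2)}.

Definition block (I J : {set 'I_n}) : Cost any_matrix :=
  M <~ submatrixA I J;;
  ret (existT (fun mq : nat * nat => 'M[R]_(mq.1, mq.2)) (#|I|, #|J|) M).

(** The basis and stacked transfer generators of a node are the matrices
    [interp_mx] of the data in [bases]. *)
Record hss : Type := HSS {
  bases : table;
  genB : seq (node * any_matrix);
  genD : seq (node * any_matrix) }.

Definition smash : Cost hss :=
  t <~ foldC process_node (fun=> None) (bottom_up L);;
  Bs <~ mapC (fun i => B <~ block (hat_row t i) (hat_col t (sibling i));;
                       ret (i, B)) (bottom_up L);;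
  Ds <~ mapC (fun i => D <~ block (row_idx i) (col_idx i);; ret (i, D))
             (level_nodes L);;
  ret (HSS t Bs Ds).

Definition nonroot (i : node) : bool := (1 < level i <= L)%N.

Definition generator_rank_le (r : nat) (H : hss) : Prop :=
  (forall (i : node) (x : node_data), nonroot i -> bases H i = Some x ->
     (\rank (interp_mx (row_compr x)) <= r)%N /\
     (\rank (interp_mx (col_compr x)) <= r)%N) /\
  all (fun B : node * any_matrix => \rank (tagged B.2) <= r)%N (genB H).

End Construction.

(* Main.v *)
Require Import Defs.
From mathcomp Require Import all_boot all_order all_algebra.
From mathcomp Require Import boolp classical_sets reals.
From mathcomp Require Import zify.
Set Implicit Arguments.
Unset Strict Implicit.
Unset Printing Implicit Defensive.
Import Order.TTheory GRing.Theory Num.Theory.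
Local Open Scope ring_scope.

(** Every matrix handled at a nonroot node has both dimensions bounded by a
    fixed multiple of [r], so each node costs a constant, and there are fewer
    than [2 ^ L] nodes, which is of order [n / r].  The hypotheses bound the
    index sets computed from the final table, whereas a node is processed with
    a partial table; the two agree because the index sets of a node, and of the
    members of its nearfield, depend only on the entries one level below, which
    bottom-up processing never changes again. *)

(** * Cost calculus for binding, iteration and matrices *)

Lemma cost_bind (T S : Type) (c : Cost T) (f : T -> Cost S) :
  cost (bind c f) = (cost c + cost (f (result c)))%N.
Proof. by []. Qed.

Lemma result_foldC_cons (T S : Type) (f : S -> T -> Cost S) (st : S) (x : T)
    (xs : seq T) :
  result (foldC f st (x :: xs)) = result (foldC f (result (f st x)) xs).
Proof. by []. Qed.

Lemma cost_mapC_le (T : eqType) (S : Type) (f : T -> Cost S) (b : nat)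
    (xs : seq T) :
  {in xs, forall x, (cost (f x) <= b)%N} ->
  (cost (mapC f xs) <= b * size xs)%N.
Proof.
elim: xs => [|x xs IH] // le_b.
rewrite [mapC _ _]/= !cost_bind addn0 [size _]/= mulnS leq_add ?le_b ?mem_head //.
by apply: IH => y yxs; rewrite le_b // in_cons yxs orbT.
Qed.

Lemma cost_matrixC (R : Type) (m q : nat) (f : 'I_m -> 'I_q -> Cost R) :
  (forall i j, cost (f i j) = 1%N) -> cost (matrixC f) = (m * q)%N.
Proof.
move=> f1; rewrite /cost /=.
rewrite (eq_bigr (fun=> q)); last first.
  by move=> i _; rewrite (eq_bigr (fun=> 1%N)) ?sum1_card ?card_ord.
by rewrite sum_nat_const card_ord.
Qed.

Lemma size_flatten_map_le (T : eqType) (S : Type) (f : T -> seq S) (b : nat)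
    (xs : seq T) :
  {in xs, forall x, (size (f x) <= b)%N} ->
  (size (flatten [seq f x | x <- xs]) <= size xs * b)%N.
Proof.
elim: xs => [|x xs IH] //= le_b.
rewrite size_cat mulSn leq_add ?le_b ?mem_head //.
by apply: IH => y yxs; rewrite le_b // in_cons yxs orbT.
Qed.

(** * Number and order of the nodes visited bottom-up *)

Lemma size_level_nodes (l : nat) : size (level_nodes l) = (2 ^ l.-1)%N.
Proof. by rewrite size_map -cardE card_tuple card_bool. Qed.

Lemma size_mem_level_nodes (l : nat) (i : node) :
  i \in level_nodes l -> size i = l.-1.
Proof. by case/mapP=> t _ ->; rewrite size_tuple. Qed.

Lemma bottom_upS (L : nat) :
  bottom_up L.+2 = level_nodes L.+2 ++ bottom_up L.+1.
Proof.
(* Written as a sum, the length lets [iotaD] split off the deepest level, which the reversal puts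
   first. *)
have -> : bottom_up L.+2 = flatten [seq level_nodes l | l <- rev (iota 2 (L + 1))].
  by rewrite addn1.
by rewrite iotaD rev_cat.
Qed.

(** Geometric sum: by induction the shallower levels together have at most as many nodes as the
    bound for the deepest level, so each new level doubles the bound. *)
Lemma size_bottom_up (L : nat) : (size (bottom_up L) <= 2 ^ L)%N.
Proof.
case: L => [|L] //; elim: L => [|L IH] //.
rewrite bottom_upS size_cat size_level_nodes /= [X in (_ <= X)%N]expnS mul2n.
by rewrite -addnn leq_add2l.
Qed.

Lemma bottom_up_nonroot (L : nat) (i : node) :
  i \in bottom_up L -> nonroot L i.
Proof.
case/flatten_mapP=> l; rewrite mem_rev mem_iota => l_in /size_mem_level_nodes.
rewrite /nonroot /level; lia.
Qed.

(** Stated with [pairwise] so that the head of a list bounds the depth of all nodes still to be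
    processed, the form used in inductions over the fold. *)
Definition deepest_first (xs : seq node) : bool :=
  pairwise (fun i j : node => size j <= size i)%N xs.

Lemma bottom_up_deepest_first (L : nat) : deepest_first (bottom_up L).
Proof.
rewrite /deepest_first; case: L => [|L] //; elim: L => [|L IH] //.
rewrite bottom_upS pairwise_cat IH andbT; apply/andP; split.
  apply/allrelP => i j /size_mem_level_nodes /= -> /bottom_up_nonroot.
  rewrite /nonroot /level; lia.
apply/(pairwiseP [::]) => a b a_lt b_lt _.
by rewrite !(size_mem_level_nodes (mem_nth _ _)).
Qed.

(** * Stability of the index sets during the sweep *)

Section Cost.
Variables (R : realType) (d n : nat) (pb : problem R d n).
Variables (rt : routines R) (tau : R) (L : nat).

Local Notation process := (process_node pb rt tau L).
Local Notation bar_row := (bar_row pb L).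
Local Notation bar_col := (bar_col pb L).
Local Notation table := (table R n).

Lemma size_nearfield (i j : node) : j \in nearfield pb tau i -> size j = size i.
Proof.
elim: i j => [|b p IH] j //=; rewrite in_cons => /orP[/eqP -> //|].
rewrite mem_filter => /andP[_ /flatten_mapP[q /IH <-]].
by rewrite !inE => /orP[] /eqP ->.
Qed.

Lemma bar_row_congr (t t' : table) (i : node) :
  (forall b, t (b :: i) = t' (b :: i)) -> bar_row t i = bar_row t' i.
Proof. by move=> tt'; rewrite /Defs.bar_row /hat_row !tt'. Qed.

Lemma bar_col_congr (t t' : table) (i : node) :
  (forall b, t (b :: i) = t' (b :: i)) -> bar_col t i = bar_col t' i.
Proof. by move=> tt'; rewrite /Defs.bar_col /hat_col !tt'. Qed.

Lemma process_nodeE (t : table) (i : node) :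
  exists2 x : node_data R n, result (process t i) = update t i x &
    nd_row x = bar_row t i /\ nd_col x = bar_col t i.
Proof. by eexists; [reflexivity | split]. Qed.

Lemma foldC_process_notin (xs : seq node) (t : table) (i : node) :
  i \notin xs -> result (foldC process t xs) i = t i.
Proof.
elim: xs t => [|x xs IH] t //; rewrite in_cons negb_or => /andP[i_x i_xs].
have [y Ey _] := process_nodeE t x.
by rewrite result_foldC_cons IH // Ey /update (negbTE i_x).
Qed.

(** A child of [i] is strictly deeper than every node of [xs], so no step overwrites its entry. *)
Lemma foldC_process_child (xs : seq node) (t : table) (i : node) (b : bool) :
  all (fun j : node => size j <= size i)%N xs ->
  result (foldC process t xs) (b :: i) = t (b :: i).
Proof.
move=> /allP le_i; apply: foldC_process_notin.
by apply/negP => /le_i /=; rewrite ltnn.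
Qed.

Lemma bar_row_foldC (xs : seq node) (t : table) (i : node) :
  all (fun j : node => size j <= size i)%N xs ->
  bar_row (result (foldC process t xs)) i = bar_row t i.
Proof. by move=> le_i; apply: bar_row_congr => b; apply: foldC_process_child. Qed.

Lemma bar_col_foldC (xs : seq node) (t : table) (i : node) :
  all (fun j : node => size j <= size i)%N xs ->
  bar_col (result (foldC process t xs)) i = bar_col t i.
Proof. by move=> le_i; apply: bar_col_congr => b; apply: foldC_process_child. Qed.

(** An entry is written from the table of its own step, and later steps leave the children, hence
    the bar sets, alone. The initial table is arbitrary for the induction, whence the first
    alternative. *)
Lemma foldC_process_data (xs : seq node) (t : table) (i : node)
    (x : node_data R n) :
  deepest_first xs ->
  let F := result (foldC process t xs) in
  F i = Some x ->
  t i = Some x \/ nd_row x = bar_row F i /\ nd_col x = bar_col F i.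
Proof.
elim: xs t => [|y ys IH] t; first by left.
move=> df F; have /andP[le_y df_ys] := df.
(* The list includes [y] itself: [F] also contains the step at [y], which does not touch the
   children of [y]. *)
have le_y' : all (fun j : node => size j <= size y)%N (y :: ys).
  by rewrite /= leqnn.
have [z Ez [z_row z_col]] := process_nodeE t y.
move=> /(IH _ df_ys) [|]; last by right.
rewrite Ez /update; case: eqP => [-> [<-]|_]; last by left.
by right; rewrite z_row z_col /F bar_row_foldC ?bar_col_foldC.
Qed.

Lemma card_global (I : {set 'I_n}) (o : compr_out R #|I|) :
  (#|global o| <= #|I|)%N.
Proof.
by apply: leq_trans (leq_imset_card _ _) _; rewrite -[leqRHS]card_ord max_card.
Qed.

(** Compression selects a subset of the rows, and a node without data has empty hat sets. This
    carries the assumed bounds over to the blocks of the [B] generators. *)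
Lemma card_hat_le (xs : seq node) (i : node) :
  deepest_first xs ->
  let F := result (foldC process (fun=> None) xs) in
  (#|hat_row F i| <= #|bar_row F i|)%N /\
  (#|hat_col F i| <= #|bar_col F i|)%N.
Proof.
move=> df F; rewrite /hat_row /hat_col.
case E: (F i) => [x|]; last by rewrite cards0.
have [//|[<- <-]] := foldC_process_data df E.
by split; apply: card_global.
Qed.

(** * Cost of one node and of the whole sweep *)

Section NodeCost.
Variables (r b k ct cc : nat).
Hypothesis tsvd_le : forall m q (M : 'M[R]_(m, q)),
  (m <= b)%N -> (q <= k * b)%N -> (cost (tsvd rt M) <= ct)%N.
Hypothesis compr_le : forall m q (M : 'M[R]_(m, q)),
  (m <= b)%N -> (q <= r + b)%N -> (cost (compr rt M) <= cc)%N.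
Hypothesis tsvd_size : forall m q (M : 'M[R]_(m, q)),
  (tag (result (tsvd rt M)) <= m)%N.

(** The factor 2 counts rows and columns; each side has a farfield basis, a nearfield block, an SVD
    and a compression. Bounds are required on the whole level because the neighbours supply the
    other dimension of the blocks. *)
Lemma cost_process_le (t : table) (i : node) :
  (size (row_basis pb i) <= r)%N -> (size (col_basis pb i) <= r)%N ->
  (size (nearfield pb tau i) <= k)%N ->
  (forall j : node, size j = size i ->
     (#|bar_row t j| <= b)%N /\ (#|bar_col t j| <= b)%N) ->
  (cost (process t i) <= 2 * (b * r + b * (k * b) + ct + cc))%N.
Proof.
move=> rbas cbas near bar_le.
have [row_i col_i] := bar_le i erefl.
have ncols : (size (near_cols pb tau L t i) <= k * b)%N.
  apply: (@leq_trans (size (nearfield pb tau i) * b)); last exact: leq_mul.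
  apply: size_flatten_map_le => j /size_nearfield /bar_le [_].
  by rewrite -cardE.
have nrows : (size (near_rows pb tau L t i) <= k * b)%N.
  apply: (@leq_trans (size (nearfield pb tau i) * b)); last exact: leq_mul.
  apply: size_flatten_map_le => j /size_nearfield /bar_le [].
  by rewrite -cardE.
rewrite /process_node !cost_bind.
rewrite ![cost (eval_basis _ _ _)]cost_matrixC //.
rewrite [cost (near_row_block _ _ _ _ _)]cost_matrixC //.
rewrite [cost (near_col_block _ _ _ _ _)]cost_matrixC //.
set NR := result (near_row_block _ _ _ _ _).
set NC := result (near_col_block _ _ _ _ _).
have tR := tsvd_le NR row_i ncols; have tC := tsvd_le NC col_i nrows.
have cR (M : 'M[R]_(_, _ + tag (result (tsvd rt NR)))) :=
  compr_le M row_i (leq_add rbas (leq_trans (tsvd_size NR) row_i)).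
have cC (M : 'M[R]_(_, _ + tag (result (tsvd rt NC)))) :=
  compr_le M col_i (leq_add cbas (leq_trans (tsvd_size NC) col_i)).
have eR := leq_mul row_i rbas; have eC := leq_mul col_i cbas.
have bR := leq_mul row_i ncols; have bC := leq_mul col_i nrows.
set X := row_mx _ _; set Y := row_mx _ _.
have := cR X; have := cC Y.
move: eR eC bR bC tR tC; rewrite /cost /=; lia.
Qed.

(** The bounds concern the final table [F], which stays the same along the induction while the
    starting table changes. *)
Lemma cost_foldC_process_le (xs : seq node) (t : table) :
  deepest_first xs ->
  {in xs, forall i, [/\ (size (row_basis pb i) <= r)%N,
     (size (col_basis pb i) <= r)%N & (size (nearfield pb tau i) <= k)%N]} ->
  let F := result (foldC process t xs) in
  {in xs, forall i j : node, size j = size i ->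
     (#|bar_row F j| <= b)%N /\ (#|bar_col F j| <= b)%N} ->
  (cost (foldC process t xs)
     <= 2 * (b * r + b * (k * b) + ct + cc) * size xs)%N.
Proof.
elim: xs t => [|x xs IH] t // df near_le F bar_le.
have /andP[le_x df_xs] := df.
have [rbas cbas near] := near_le x (mem_head _ _).
rewrite [foldC _ _ _]/= cost_bind mulnS leq_add //.
  apply: cost_process_le => // j size_j.
  (* No remaining node is deeper than [j], so the bound in [F] is also one in the current table
     [t]. *)
  have le_j : all (fun k : node => size k <= size j)%N (x :: xs).
    by rewrite /= size_j leqnn.
  have := bar_le x (mem_head _ _) j size_j.
  by rewrite /F bar_row_foldC ?bar_col_foldC.
apply: IH => // i i_xs; first by apply: near_le; rewrite in_cons i_xs orbT.
by apply: bar_le; rewrite in_cons i_xs orbT.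
Qed.

End NodeCost.

Lemma cost_block (I J : {set 'I_n}) : cost (block pb I J) = (#|I| * #|J|)%N.
Proof. by rewrite /block cost_bind addn0 cost_matrixC. Qed.

End Cost.

(** Bounds the width of the matrices passed to [compr], whatever the truncation criterion. *)
Lemma tsvd_correct_size (R : realType) (rt : routines R) (m q : nat)
    (M : 'M[R]_(m, q)) :
  tsvd_correct rt -> (tag (result (tsvd rt M)) <= m)%N.
Proof.
move=> /(_ m q M) [U [sigma [V [_ [le_k _]]]]].
exact: leq_trans le_k (geq_minl _ _).
Qed.

Theorem theorem5p1 (R : realType) (d : nat) (tau s : R) (rt : routines R)
    (tau_gt0 : 0 < tau) (tau_lt1 : tau < 1) (s_gt1 : 1 < s)
    (tsvdP : tsvd_correct rt) (comprP : compr_correct s rt)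
    (tsvd_cost : cubic_cost (fun m q (M : 'M[R]_(m, q)) => cost (tsvd rt M)))
    (compr_cost : cubic_cost (fun m q (M : 'M[R]_(m, q)) => cost (compr rt M)))
    (r : nat) (r_gt0 : (0 < r)%N) (c1 c2 K : nat) :
  exists C : nat, forall (n L : nat) (pb : problem R d n),
    (0 < L)%N ->
    (n <= c1 * (r * 2 ^ L))%N -> (r * 2 ^ L <= c2 * n)%N ->
    ptX pb = ptY pb -> injective (ptX pb) ->
    domain_tree pb L -> uniformly_distributed pb L K ->
    (forall i : node, nonroot L i ->
       (size (row_basis pb i) <= r)%N /\ (size (col_basis pb i) <= r)%N) ->
    let H := result (smash pb rt tau L) in
    generator_rank_le L r H ->
    (forall i : node, nonroot L i ->
       (#|bar_row pb L (bases H) i| <= 2 * r)%N /\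
       (#|bar_col pb L (bases H) i| <= 2 * r)%N) ->
    (forall i : node, (level i <= L)%N -> (size (nearfield pb tau i) <= 3)%N) ->
    (cost (smash pb rt tau L) <= C * n)%N.
Proof.
(* Three neighbours with at most [2 * r] indices each give [6 * r] columns; the compressed matrix
   has at most [r + 2 * r] columns. *)
have [ct ctP] := tsvd_cost 6; have [cc ccP] := compr_cost 3.
(* [N] bounds the processing of a node, [B] a block with both sides at most [2 * r], and [D] the
   diagonal block when the root is the only leaf. *)
pose N := (2 * (2 * r * r + 2 * r * (3 * (2 * r)) + ct * r ^ 3 + cc * r ^ 3))%N.
pose B := (2 * r * (2 * r))%N; pose D := (2 * c1 * r * (2 * c1 * r))%N.
exists ((N + B + (B + D)) * c2)%N.
move=> n L pb L_gt0 n_le L_le _ _ _ _ basis_le H _ bar_le near_le.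
pose t := result (foldC (process_node pb rt tau L) (fun=> None) (bottom_up L)).
have {}bar_le i : nonroot L i ->
    (#|bar_row pb L t i| <= 2 * r)%N /\ (#|bar_col pb L t i| <= 2 * r)%N.
  exact: bar_le.
have df := bottom_up_deepest_first L.
have hat_le i : nonroot L i ->
    (#|hat_row t i| <= 2 * r)%N /\ (#|hat_col t i| <= 2 * r)%N.
  move=> /bar_le [row_i col_i].
  have [hrow hcol] := card_hat_le pb rt tau L i df.
  by split; [apply: leq_trans row_i | apply: leq_trans col_i].
have fold_le : (cost (foldC (process_node pb rt tau L) (fun=> None)
    (bottom_up L)) <= N * size (bottom_up L))%N.
  apply: cost_foldC_process_le => //.
  - by move=> m q M m_le q_le; apply: ctP => //; lia.
  - by move=> m q M m_le q_le; apply: ccP => //; lia.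
  - by move=> m q M; apply: tsvd_correct_size.
  - move=> i /bottom_up_nonroot nr_i; have [rbas cbas] := basis_le i nr_i.
    by split=> //; apply: near_le; case/andP: nr_i.
  - move=> i /bottom_up_nonroot nr_i j size_j; apply: bar_le.
    by move: nr_i; rewrite /nonroot /level size_j.
have B_le : (cost (mapC (fun i => C <~ block pb (hat_row t i)
    (hat_col t (sibling i));; ret (i, C)) (bottom_up L))
    <= B * size (bottom_up L))%N.
  apply: cost_mapC_le => i /bottom_up_nonroot nr_i.
  rewrite cost_bind addn0 cost_block leq_mul ?(hat_le _ _).1 //.
  (* For a nonempty path the sibling has the same length, hence is nonroot too. *)
  by rewrite (hat_le _ _).2 //; case: i nr_i.
have D_le : (cost (mapC (fun i => C <~ block pb (row_idx pb i)
    (col_idx pb i);; ret (i, C)) (level_nodes L))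
    <= (B + D) * size (level_nodes L))%N.
  apply: cost_mapC_le => i /size_mem_level_nodes size_i.
  rewrite cost_bind addn0 cost_block.
  have level_i : level i = L by rewrite /level size_i prednK.
  have [L_gt1|L_le1] := ltnP 1 L.
    have nr_i : nonroot L i by rewrite /nonroot level_i L_gt1 leqnn.
    have := bar_le i nr_i; rewrite /bar_row /bar_col level_i eqxx => -[ri ci].
    by rewrite (leq_trans (leq_mul ri ci)) // leq_addr.
  (* With a single level the only diagonal block is [A] itself, and
     [n <= 2 * c1 * r]. *)
  have n_le' : (n <= 2 * c1 * r)%N.
    have L1 : L = 1 by lia.
    by move: n_le; rewrite L1 expn1; lia.
  apply: leq_trans (leq_addl _ _); apply: leq_mul; apply: leq_trans n_le'.
    by rewrite -[leqRHS]card_ord max_card.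
  by rewrite -[leqRHS]card_ord max_card.
have pow_le : (2 ^ L <= c2 * n)%N.
  by apply: leq_trans L_le; rewrite leq_pmull.
(* It remains to bound the cost by a constant times [2 ^ L], a bound for both the number of nonroot
   nodes and the number of leaves. *)
rewrite -mulnA; apply: leq_trans (leq_mul (leqnn _) pow_le).
rewrite /smash !cost_bind /= addn0 addnA -/t mulnDl mulnDl.
have up_le := size_bottom_up L.
have leaves_le : (size (level_nodes L) <= 2 ^ L)%N.
  by rewrite size_level_nodes leq_exp2l // leq_pred.
rewrite !leq_add //.
- by apply: leq_trans fold_le _; rewrite leq_mul.
- by apply: leq_trans B_le _; rewrite leq_mul.
- by apply: leq_trans D_le _; rewrite leq_mul.
Qed.
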